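(* Let $I\subset R=K[x_1,\ldots,x_n]$ be a complete intersection monomial ideal with minimal monomial generating set $G(I)=\{\mathbf{x}^{\mathbf{a}_1},\ldots,\mathbf{x}^{\mathbf{a}_k}\}$, the $k$ generators being distinct, and let $d_i=\deg(\mathbf{x}^{\mathbf{a}_i})$ for $i=1,\ldots,k$. Then $$\mathrm{v}(I)=d_1+\cdots+d_k-k=\mathrm{reg}(R/I).$$
   Context: $K$ is a field and $R$ has the standard grading, with degree-$d$ component $R_d$. A monomial ideal $I$ is a complete intersection if it is proper and $|G(I)|=\mathrm{ht}(I)$. For a proper graded ideal $I$ of $R$, its v-number is $\mathrm{v}(I)=\min\{d\ge 0 : \exists f\in R_d \text{ and } \mathfrak{p}\in\mathrm{Ass}(R/I)\text{ with } (I:f)=\mathfrak{p}\}$. $\mathrm{reg}(R/I)$ is the Castelnuovo-Mumford regularity, $\max\{j-i:\beta_{i,j}(R/I)\ne0\}$. *)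

(* Defs.v *)
From HB Require Import structures.
From mathcomp Require Import all_boot all_order all_algebra.
From mathcomp Require Export mpoly.

Set Implicit Arguments.
Unset Strict Implicit.
Unset Printing Implicit Defensive.

Import GRing.Theory.

Local Open Scope ring_scope.

(* Ideals are collective boolean predicates, as in ring_quotient; classically
   these are all the subsets of the ring.  Beware that [idealr_closed] and the
   bundled type [prime_idealr] of that file include properness. *)

Section Height.

Variable R : comNzRingType.
Implicit Types (I : {pred R}) (p : prime_idealr R) (h l : nat).

Definition prime_chain p l : Prop :=
  exists2 q : nat -> prime_idealr R, (q l : {pred R}) =i p &
    forall i, (i < l)%N ->
      {subset (q i : {pred R}) <= (q i.+1 : {pred R})} /\
      ~ {subset (q i.+1 : {pred R}) <= (q i : {pred R})}.

Definition is_prime_height p h : Prop :=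
  prime_chain p h /\ forall l, prime_chain p l -> (l <= h)%N.

(* Primes of infinite height do not affect the minimum. *)
Definition is_height I h : Prop :=
  (exists2 p : prime_idealr R,
     {subset I <= (p : {pred R})} & is_prime_height p h) /\
  (forall (p : prime_idealr R) h',
     {subset I <= (p : {pred R})} -> is_prime_height p h' -> (h <= h')%N).

Definition colon I (f : R) : {pred R} := [pred g | g * f \in I].

(* The annihilator of the class of g in R/I is the colon ideal (I : g). *)
Definition associated_prime I p : Prop :=
  exists g : R, colon I g =i (p : {pred R}).

End Height.

Section GradedIdeals.

Variables (K : fieldType) (n : nat).
Local Notation R := {mpoly K[n]}.
Implicit Types (I : {pred R}) (G H : seq 'X_{1..n}).

Definition mon_generates G I : Prop :=
  forall f : R, f \in I <->
    exists c : 'X_{1..n} -> R, f = \sum_(m <- G) c m * 'X_[m].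

(* G enumerates, without repetition, the minimal monomial generating set of
   I; in particular I is a monomial ideal. *)
Definition min_mon_generators I G : Prop :=
  [/\ uniq G, mon_generates G I &
      forall H, {subset H <= G} -> mon_generates H I -> {subset G <= H}].

Definition complete_intersection I : Prop :=
  1 \notin I /\
  exists2 G, min_mon_generators I G & is_height I (size G).

Definition v_degree I (d : nat) : Prop :=
  exists f : R, exists p : prime_idealr R,
    [/\ f \is d.-homog, associated_prime I p & colon I f =i (p : {pred R})].

Definition is_v_number I (v : nat) : Prop :=
  v_degree I v /\ forall d, v_degree I d -> (v <= d)%N.

(* Data of a complex ... -> F_2 -> F_1 -> F_0 -> R/I of free modules
   F_i = R(-j_{i,0}) + ... + R(-j_{i,r_i - 1}), where r_i = [frank F i] and
   j_{i,s} = [fshift F s].  Elements of F_i are row vectors, on which the maps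
   act by multiplication on the right; the map F_0 -> R/I sends u to the class
   of u *m [faug F]. *)
Record free_complex := FreeComplex {
  frank : nat -> nat;
  fshift : forall i, 'I_(frank i) -> int;
  fdiff : forall i, 'M[R]_(frank i.+1, frank i);
  faug : 'cV[R]_(frank 0)
}.

Arguments fshift F {i} s : rename.

(* f is homogeneous of degree e; only 0 is so when e < 0. *)
Definition homog_of_degree (e : int) (f : R) : Prop :=
  forall m, m \in msupp f -> (mdeg m)%:Z = e.

Definition graded_complex (F : free_complex) : Prop :=
  (forall s, homog_of_degree (fshift F s) (faug F s 0)) /\
  (forall i s t,
     homog_of_degree (fshift F s - fshift F t) (fdiff F i s t)).

Definition resolves (F : free_complex) I : Prop :=
  [/\ forall f : R, exists u : 'rV_(frank F 0), f - (u *m faug F) 0 0 \in I,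
      forall u : 'rV_(frank F 0), (u *m faug F) 0 0 \in I <->
        exists w : 'rV_(frank F 1), u = w *m fdiff F 0 &
      forall i (u : 'rV_(frank F i.+1)), u *m fdiff F i = 0 <->
        exists w : 'rV_(frank F i.+2), u = w *m fdiff F i.+1].

(* The differentials map into (x_1, ..., x_n) F_i. *)
Definition minimal_complex (F : free_complex) : Prop :=
  forall i s t, (fdiff F i s t)@_0%MM = 0.

Definition min_graded_free_resolution (F : free_complex) I : Prop :=
  [/\ graded_complex F, resolves F I & minimal_complex F].

Definition betti (F : free_complex) (i : nat) (j : int) : nat :=
  #|[set s : 'I_(frank F i) | fshift F s == j]|.

Definition is_max_betti_degree (F : free_complex) (r : int) : Prop :=
  (exists i j, betti F i j <> 0%N /\ j - i%:Z = r) /\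
  (forall i j, betti F i j <> 0%N -> j - i%:Z <= r).

(* The Betti numbers of R/I are those of its minimal graded free resolution,
   which exists and is unique up to isomorphism. *)
Definition is_regularity I (r : int) : Prop :=
  (exists F, min_graded_free_resolution F I) /\
  (forall F, min_graded_free_resolution F I -> is_max_betti_degree F r).

End GradedIdeals.

(* Main.v *)
Require Import Defs.
From mathcomp Require Import all_boot all_order all_algebra zify.
From HB Require Import structures.

(** Write the generators as a_1, ..., a_k.  None of them is 1, as I is proper.

    Height k forces their supports to be pairwise disjoint.  Indeed, if a
    variable divided two generators, it would, together with one variable of
    each other generator, generate a prime containing I with fewer than k
    generators, whose height is therefore less than k.  This uses that a prime
    generated by s variables has height s ([var_prime_height]).  For the upper
    bound, take a chain of primes of length l ending there, and pick in each
    prime an element outside the previous one.  With the n - s other variables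
    these elements are algebraically independent ([alg_indep_cons]), and a
    count of monomials shows that K[x_1, ..., x_n] has no n + 1 algebraically
    independent elements ([alg_indep_size]).

    For the v-number, choose a variable t_i of each a_i and let w be the product
    of the a_i / t_i.  As the supports are disjoint, (I : w) is the prime
    (t_1, ..., t_k), so v(I) is at most the degree of w, the sum of the d_i - 1.
    Conversely a prime (I : f) contains a variable t_i of each a_i, because it
    contains a_i; a monomial of f outside I which each t_i moves into I is then
    divisible by every a_i / t_i ([prime_colon_degree]).

    For the regularity, each a_i is a nonzerodivisor modulo the previous ones,
    so iterating mapping cones of multiplication by a_i, starting from R, gives
    a minimal graded free resolution: the Koszul complex
    ([koszul_resolution]).  Each cone raises the maximum of j - i by d_i - 1.
    Any two minimal graded free resolutions have the same set of shifts in
    each homological degree ([minimal_resolution_shift]): comparison maps between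
    them are mutually inverse up to homotopy, hence mutually inverse modulo the
    variables, where the differentials vanish.  So the maximum computed on the
    Koszul complex is the one of every minimal resolution. *)

Set Implicit Arguments.
Unset Strict Implicit.
Unset Printing Implicit Defensive.

Import GRing.Theory.

Local Open Scope ring_scope.

(** * Monomial ideals *)

Section MonomialIdeals.

Variables (K : fieldType) (n : nat).
Local Notation R := {mpoly K[n]}.
Implicit Types (I J : {pred R}) (f : R) (m : 'X_{1..n}) (G H : seq 'X_{1..n}).

Definition mon_ideal G : {pred R} :=
  [pred f : R | all (fun m => has (fun a => (a <= m)%MM) G) (msupp f)].

Lemma mon_idealP G f :
  reflect (forall m, m \in msupp f -> exists2 a, a \in G & (a <= m)%MM)
          (f \in mon_ideal G).
Proof. by apply: (iffP allP) => h m /h /hasP. Qed.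

Lemma mon_idealX G m :
  ('X_[m] \in mon_ideal G) = has (fun a => (a <= m)%MM) G.
Proof. by rewrite unfold_in /= msuppX /= andbT. Qed.

Lemma mon_ideal0 G : 0 \in mon_ideal G.
Proof. by apply/mon_idealP => m; rewrite msupp0. Qed.

Lemma mon_idealD G : {in mon_ideal G &, forall f g, f + g \in mon_ideal G}.
Proof.
move=> f g /mon_idealP hf /mon_idealP hg; apply/mon_idealP => m.
by move/msuppD_le; rewrite mem_cat => /orP [/hf|/hg].
Qed.

Lemma mon_idealN G f : f \in mon_ideal G -> - f \in mon_ideal G.
Proof.
move=> /mon_idealP hf; apply/mon_idealP => m.
by rewrite (perm_mem (msuppN f)) => /hf.
Qed.

Lemma mon_idealB G : {in mon_ideal G &, forall f g, f - g \in mon_ideal G}.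
Proof. by move=> f g hf hg; rewrite mon_idealD ?mon_idealN. Qed.

Lemma mon_idealM G f (g : R) : g \in mon_ideal G -> f * g \in mon_ideal G.
Proof.
move=> /mon_idealP hg; apply/mon_idealP => m /msuppM_le /allpairsP[[m1 m2]] /=.
case=> _ /hg[a aG le_a ->]; exists a => //.
exact: lepm_trans le_a (lem_addl _ _).
Qed.

Lemma mon_ideal_sum G (T : Type) (r : seq T) (P : pred T) (F : T -> R) :
  (forall t, P t -> F t \in mon_ideal G) ->
  \sum_(t <- r | P t) F t \in mon_ideal G.
Proof.
move=> hF; apply: (big_ind (fun f => f \in mon_ideal G)) => //.
  exact: mon_ideal0.
exact: mon_idealD.
Qed.

Lemma mon_ideal_subset G H : {subset H <= G} ->
  {subset mon_ideal H <= mon_ideal G}.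
Proof.
move=> sHG f /mon_idealP hf; apply/mon_idealP => m /hf[g gH le_g].
by exists g => //; apply: sHG.
Qed.

Lemma mon_ideal_nil f : (f \in mon_ideal [::]) = (f == 0).
Proof.
apply/mon_idealP/eqP => [h|-> m]; last by rewrite msupp0.
apply/eqP; rewrite -msupp_eq0; case: (msupp f) h => // m s h.
by case: (h m); rewrite ?mem_head.
Qed.

Lemma mpolyX_dvd m1 m2 : (m1 <= m2)%MM ->
  'X_[m2] = 'X_[m2 - m1] * 'X_[m1] :> R.
Proof. by move=> le_m; rewrite -mpolyXD submK. Qed.

Lemma mem_mon_ideal_mulX G m f :
  (f * 'X_[m] \in mon_ideal G) =
  all (fun m' => has (fun a => (a <= m + m')%MM) G) (msupp f).
Proof.
rewrite unfold_in /=; have /perm_mem e := msuppMX f m; rewrite (eq_all_r e).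
by rewrite all_map.
Qed.

(** The equivalence sorts the terms of a polynomial by a generator dividing
    their monomial. *)
Lemma mon_generates_mon_ideal G : uniq G -> mon_generates G (mon_ideal G).
Proof.
move=> uG f; split=> [fG|[c ->]]; last first.
  rewrite big_seq; apply: mon_ideal_sum => m mG; apply: mon_idealM.
  by rewrite mon_idealX; apply/hasP; exists m => //; apply: lepm_refl.
rewrite [f]mpolyE big_seq.
apply: (big_ind (fun f => exists c, f = \sum_(m <- G) c m * 'X_[m])).
- by exists (fun=> 0); rewrite big1 // => m _; rewrite mul0r.
- move=> _ _ [c1 ->] [c2 ->]; exists (fun m => c1 m + c2 m).
  by rewrite -big_split; apply: eq_bigr => m _; rewrite mulrDl.
move=> m /(mon_idealP _ _ fG)[g gG le_g].
exists (fun h => if h == g then f@_m *: 'X_[m - g] else 0).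
rewrite (bigD1_seq g) //= eqxx big1 => [|h /negPf->]; last by rewrite mul0r.
by rewrite addr0 -scalerAl -mpolyX_dvd.
Qed.

Lemma mon_generatesE G I : uniq G -> mon_generates G I -> I =i mon_ideal G.
Proof.
move=> uG hI f; apply/idP/idP.
  by move/hI/(mon_generates_mon_ideal uG).
by move/(mon_generates_mon_ideal uG)/hI.
Qed.

Lemma eq_mon_generates G I J : I =i J ->
  mon_generates G I -> mon_generates G J.
Proof. by move=> eI hI f; rewrite -eI. Qed.

(** If [g] properly divided [m], then [m] could be discarded. *)
Lemma min_mon_generators_antichain G I g m : min_mon_generators I G ->
  g \in G -> m \in G -> (g <= m)%MM -> g = m.
Proof.
case=> uG hI minG gG mG le_gm; apply/eqP/negPn/negP => ne_gm.
have sHG : {subset rem m G <= G} by move=> x; apply: mem_rem.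
have /(minG _ sHG)/(_ m mG) : mon_generates (rem m G) I.
  apply: eq_mon_generates (mon_generates_mon_ideal (rem_uniq m uG)) => f.
  rewrite (mon_generatesE uG hI); apply/idP/idP => [/(mon_ideal_subset sHG)//|].
  move=> /mon_idealP hf; apply/mon_idealP => x /hf[h hG le_h].
  have [e|ne] := eqVneq h m; last by exists h => //; rewrite mem_rem_uniq // inE ne.
  exists g; first by rewrite mem_rem_uniq // inE ne_gm.
  by apply: lepm_trans le_gm _; rewrite -e.
by rewrite mem_rem_uniq // inE eqxx.
Qed.

Lemma lem_antisym m1 m2 : (m1 <= m2)%MM -> (m2 <= m1)%MM -> m1 = m2.
Proof.
move=> /mnm_lepP h1 /mnm_lepP h2; apply/mnmP => i.
by apply/eqP; rewrite eqn_leq h1 h2.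
Qed.

(** A generator [m] of [G] is divisible by some [h] in [H], itself divisible by
    some [g] in [G]; then [g = m], hence [h = m]. *)
Lemma min_mon_generators_unique G H I :
  min_mon_generators I G -> min_mon_generators I H -> G =i H.
Proof.
suff sub G' H' : min_mon_generators I G' -> min_mon_generators I H' ->
    {subset G' <= H'}.
  by move=> mG mH m; apply/idP/idP; apply: sub.
move=> mG mH m mG'.
have [[uG hG _] [uH hH _]] := (mG, mH).
have : 'X_[m] \in mon_ideal H'.
  rewrite -(mon_generatesE uH hH) (mon_generatesE uG hG) mon_idealX.
  by apply/hasP; exists m => //; apply: lepm_refl.
rewrite mon_idealX => /hasP[h hH' le_hm].
have : 'X_[h] \in mon_ideal G'.
  rewrite -(mon_generatesE uG hG) (mon_generatesE uH hH) mon_idealX.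
  by apply/hasP; exists h => //; apply: lepm_refl.
rewrite mon_idealX => /hasP[g gG le_gh].
have e := min_mon_generators_antichain mG gG mG' (lepm_trans le_gh le_hm).
by rewrite (lem_antisym (m1 := m) (m2 := h)) // -e.
Qed.

End MonomialIdeals.

(** * Primes generated by variables *)

Section VariablePrimes.

Variables (K : fieldType) (n : nat).
Local Notation R := {mpoly K[n]}.
Implicit Types (f g : R) (m : 'X_{1..n}) (S T : {set 'I_n}).

(** The prime generated by the variables in [S] is realized as the kernel of
    this endomorphism of a domain, which makes primality immediate. *)
Definition kill_vars S : R -> R :=
  mmap (@mpolyC n K) (fun i => if i \in S then 0 else 'X_i).

HB.instance Definition _ S := GRing.RMorphism.copy (kill_vars S)
  (mmap (@mpolyC n K) (fun i => if i \in S then 0 else 'X_i)).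

Lemma kill_varsX S m :
  kill_vars S 'X_[m] = if [exists i in S, m i != 0%N] then 0 else 'X_[m].
Proof.
rewrite /kill_vars mmapX /mmap1; case: ifP => [/exists_inP[i iS mi]|hm].
  by rewrite (bigD1 i) //= iS expr0n (negPf mi) mul0r.
rewrite mpolyXE_id; apply: eq_bigr => i _; case: ifP => // iS.
move/negbT: hm; rewrite negb_exists_in => /forall_inP/(_ i iS).
by rewrite negbK => /eqP->; rewrite !expr0.
Qed.

Lemma mcoeff_kill_vars S f m :
  (kill_vars S f)@_m = if [exists i in S, m i != 0%N] then 0 else f@_m.
Proof.
elim/mpolyind: f => [|c m' f _ _ IH]; first by rewrite raddf0 mcoeff0 if_same.
rewrite raddfD /= !mcoeffD IH -mul_mpolyC rmorphM /= /kill_vars mmapC.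
rewrite -/(kill_vars S _) kill_varsX !mul_mpolyC.
have [->|ne] := eqVneq m' m; first by case: ifP; rewrite ?scaler0 ?mcoeff0 ?addr0.
have z : (c *: 'X_[m'])@_m = 0 by rewrite mcoeffZ mcoeffX (negPf ne) mulr0.
by case: ifP => _; rewrite ?scaler0 ?mcoeff0 z !add0r.
Qed.

Definition var_prime S (f : R) : bool := kill_vars S f == 0.

Lemma var_primeP S f :
  reflect (forall m, m \in msupp f -> exists2 i, i \in S & m i != 0%N)
          (f \in (var_prime S : {pred R})).
Proof.
apply: (iffP eqP) => [h m|h].
  rewrite mcoeff_msupp => fm; apply/exists_inP; apply: contraNT fm => hm.
  by have := mcoeff_kill_vars S f m; rewrite h mcoeff0 (negPf hm) => <-.
apply/mpolyP => m; rewrite mcoeff0 mcoeff_kill_vars; case: ifPn => // hm.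
apply/eqP; rewrite mcoeff_eq0; apply: contraNN hm => /h[i iS mi].
by apply/exists_inP; exists i.
Qed.

Lemma var_prime_idealr_closed S : idealr_closed (var_prime S).
Proof.
split=> [||a f g]; rewrite !unfold_in /var_prime ?raddf0 ?rmorph1 ?oner_eq0 //.
by move=> /eqP hf /eqP hg; rewrite rmorphD rmorphM /= hf hg mulr0 addr0.
Qed.

Lemma var_prime_prime_closed S : prime_idealr_closed (var_prime S).
Proof. by move=> f g; rewrite !unfold_in /var_prime rmorphM mulf_eq0. Qed.

HB.instance Definition _ S := isIdealr.Build R (var_prime S)
  (var_prime_idealr_closed S).
HB.instance Definition _ S := isPrimeIdealrClosed.Build R (var_prime S)
  (@var_prime_prime_closed S).

Definition var_prime_ideal S : prime_idealr R := var_prime S.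

Lemma var_prime_subset S T : S \subset T ->
  {subset (var_prime_ideal S : {pred R}) <= (var_prime_ideal T : {pred R})}.
Proof.
move=> /subsetP sST f /var_primeP hf; apply/var_primeP => m /hf[i iS mi].
by exists i; rewrite ?sST.
Qed.

Lemma var_primeX S i : ('X_i \in (var_prime_ideal S : {pred R})) = (i \in S).
Proof.
apply/var_primeP/idP => [/(_ U_(i)%MM)|iS m].
  rewrite msuppX mem_head => -[//|j jS]; rewrite mnm1E.
  by have [->|] := eqVneq i j.
by rewrite msuppX inE => /eqP->; exists i; rewrite // mnm1E eqxx.
Qed.

End VariablePrimes.

(** * Heights of primes in a polynomial ring *)

Section Dimension.

Variables (K : fieldType) (n : nat).
Local Notation R := {mpoly K[n]}.
Implicit Types (q : {pred R}) (f g : R) (fs : seq R) (c d : seq nat -> K).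

(** The value at [fs] of the polynomial of degree less than [M] in each variable
    whose coefficients are given by [c] on lists of exponents.  Recursion on
    the variables lets a relation be sorted by the powers of the first one. *)
Fixpoint eval_box fs (M : nat) c : R :=
  if fs is f :: fs' then
    \sum_(j < M) f ^+ j * eval_box fs' M (fun e => c (val j :: e))
  else (c [::])%:MP.

Definition in_box (N M : nat) (e : seq nat) : bool :=
  (size e == N) && all (ltn^~ M) e.

(** Algebraic independence over [K] of the classes modulo [q]. *)
Definition alg_indep q fs : Prop :=
  forall M c, eval_box fs M c \in q ->
    forall e, in_box (size fs) M e -> c e = 0.

Lemma eval_box_linear fs M a c d cd :
  (forall e, cd e = a * c e + d e) ->
  eval_box fs M cd = a *: eval_box fs M c + eval_box fs M d.
Proof.
elim: fs c d cd => [|f fs IH] c d cd cdE /=.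
  by rewrite cdE mpolyCD mpolyCM mul_mpolyC.
rewrite scaler_sumr -big_split; apply: eq_bigr => j _ /=.
by rewrite (IH (fun e => c (val j :: e)) (fun e => d (val j :: e))) // mulrDr scalerAr.
Qed.

Lemma eval_box0 fs M c :
  (forall e, in_box (size fs) M e -> c e = 0) -> eval_box fs M c = 0.
Proof.
elim: fs c => [|f fs IH] c c0 /=; first by rewrite c0 ?mpolyC0.
rewrite big1 // => j _; rewrite IH ?mulr0 // => e /andP[sz_e lt_e].
by apply: c0; rewrite /in_box /= eqSS sz_e lt_e ltn_ord.
Qed.

(** In a relation modulo [q], the terms free of [f] form a relation modulo [q'],
    since [f] vanishes there; hence they are zero, and the rest of the relation
    can be divided by [f], which is not in the prime [q]. *)
Lemma alg_indep_cons (q q' : prime_idealr R) f fs :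
  {subset (q : {pred R}) <= (q' : {pred R})} ->
  f \in (q' : {pred R}) -> f \notin (q : {pred R}) ->
  alg_indep (q' : {pred R}) fs -> alg_indep (q : {pred R}) (f :: fs).
Proof.
move=> sqq' fq' fq ind.
have step (M l : nat) (g : nat -> seq nat -> K) :
    \sum_(j < l) f ^+ j * eval_box fs M (g j) \in (q : {pred R}) ->
    forall j e, (j < l)%N -> in_box (size fs) M e -> g j e = 0.
  elim: l g => // l IH g; rewrite big_ord_recl expr0 mul1r.
  under eq_bigr => i _ do rewrite exprS -mulrA.
  rewrite -mulr_sumr => hq.
  have g0 e : in_box (size fs) M e -> g 0%N e = 0.
    apply: ind; have := sqq' _ hq; rewrite rpredDr //.
    by rewrite mulrC idealMr.
  move: hq; rewrite (eval_box0 g0) add0r prime_idealrM (negPf fq) /=.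
  by move=> /(IH (fun j => g j.+1)) h [|j] e; [move=> _; apply: g0 | apply: h].
move=> M c /= hq [|j e]; first by rewrite /in_box.
rewrite /in_box /= eqSS => /and3P[sz_e lt_j lt_e].
by apply: (step M M (fun j e => c (j :: e)) hq) => //; rewrite /in_box sz_e.
Qed.

Lemma eq_alg_indep q q' fs : q =i q' -> alg_indep q fs -> alg_indep q' fs.
Proof. by move=> eq ind M c hc; apply: ind; rewrite eq. Qed.

Lemma alg_indep_vars (S : {set 'I_n}) (s : seq 'I_n) :
  uniq s -> {in s, forall i, i \notin S} ->
  alg_indep (var_prime_ideal K S : {pred R}) [seq 'X_i | i <- s].
Proof.
elim: s S => [|i s IH] S /=.
  move=> _ _ M c /= hc [|//] _; apply/eqP; apply: contraTT hc => c0.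
  apply/negP => /var_primeP/(_ 0%MM); rewrite msuppC (negPf c0) mem_head.
  by case=> // j _; rewrite mnm0E.
move=> /andP[is_ us] sS; apply: (@alg_indep_cons _ (var_prime_ideal K (i |: S))).
- by apply: var_prime_subset; apply: subsetUr.
- by rewrite var_primeX setU11.
- by rewrite var_primeX sS ?mem_head.
apply: IH => // j js; rewrite in_setU1 negb_or sS ?inE ?js ?orbT // andbT.
by apply: contraNneq is_ => <-.
Qed.

Definition deg_le (D : nat) f : bool := all (fun m => mdeg m <= D)%N (msupp f).

Lemma deg_leP D f :
  reflect {in msupp f, forall m, (mdeg m <= D)%N} (deg_le D f).
Proof. exact: allP. Qed.

Lemma deg_leM D E f g : deg_le D f -> deg_le E g -> deg_le (D + E) (f * g).
Proof.
move=> /deg_leP hf /deg_leP hg; apply/deg_leP => m /msuppM_le.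
by move=> /allpairsP[[m1 m2] /= [/hf h1 /hg h2 ->]]; rewrite mdegD leq_add.
Qed.

Lemma deg_le_sum D (T : Type) (r : seq T) (F : T -> R) :
  (forall t, deg_le D (F t)) -> deg_le D (\sum_(t <- r) F t).
Proof.
move=> hF; apply: (big_ind (fun f => deg_le D f)) => //.
  by apply/deg_leP => m; rewrite msupp0.
move=> f g /deg_leP hf /deg_leP hg; apply/deg_leP => m /msuppD_le.
by rewrite mem_cat => /orP[/hf|/hg].
Qed.

Lemma deg_le_trans D E f : (D <= E)%N -> deg_le D f -> deg_le E f.
Proof.
by move=> le /deg_leP hf; apply/deg_leP => m /hf h; apply: leq_trans h le.
Qed.

Lemma deg_leX D j f : deg_le D f -> deg_le (j * D) (f ^+ j).
Proof.
move=> hf; elim: j => [|j IH]; last by rewrite exprS mulSn deg_leM.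
apply/deg_leP => m.
by rewrite expr0 msupp1 inE => /eqP->; rewrite mdeg0.
Qed.

Lemma deg_le_eval_box D fs M c :
  all (deg_le D) fs -> deg_le (size fs * (M * D)) (eval_box fs M c).
Proof.
elim: fs c => [|f fs IH] c /=.
  move=> _; apply/deg_leP => m; rewrite msuppC; case: ifP => // _.
  by rewrite inE => /eqP->; rewrite mdeg0.
move=> /andP[hf hfs]; apply: deg_le_sum => j; rewrite mulSn.
apply: deg_leM; last exact: IH.
by apply: deg_le_trans (deg_leX j hf); rewrite leq_mul2r (ltnW (ltn_ord j)) orbT.
Qed.

Lemma card_bmultinom (B : nat) : (#|{: 'X_{1..n < B}}| <= B ^ n)%N.
Proof.
case: B => [|B]; first by rewrite eq_card0 // => m; have := bmdeg m.
pose h (m : 'X_{1..n < B.+1}) : {ffun 'I_n -> 'I_B.+1} := [ffun i => inord (m i)].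
have lt (m : 'X_{1..n < B.+1}) i : (m i < B.+1)%N.
  apply: leq_ltn_trans (bmdeg m); rewrite mdegE (bigD1 i) //=; exact: leq_addr.
have /leq_card : injective h.
  move=> m1 m2 /ffunP e; apply/val_inj/mnmP => i; have := congr1 val (e i).
  by rewrite !ffunE /= !inordK.
by rewrite card_ffun !card_ord.
Qed.

(** The coefficients of the images of the basis vectors form a matrix with more
    rows than columns. *)
Lemma mpoly_linear_relation (r B : nat) (phi : 'rV[K]_r -> R) :
  linear phi -> (forall v, deg_le B (phi v)) -> (B.+1 ^ n < r)%N ->
  exists2 v, v != 0 & phi v = 0.
Proof.
move=> lin_phi deg_phi lt_r.
pose Phi : {linear 'rV[K]_r -> R} :=
  HB.pack phi (GRing.isLinear.Build _ _ _ _ phi lin_phi).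
pose A := \matrix_(t < r, m < #|{: 'X_{1..n < B.+1}}|)
  (phi (delta_mx 0 t))@_(enum_val m).
have phiE v (m : 'X_{1..n < B.+1}) : (phi v)@_m = (v *m A) 0 (enum_rank m).
  rewrite -[phi]/(Phi : _ -> _) {1}[v]row_sum_delta linear_sum raddf_sum mxE.
  by apply: eq_bigr => t _; rewrite linearZ /= mcoeffZ mxE enum_rankK.
have [|v vA v0] := @rowV0Pn _ _ _ (kermx A) _.
  rewrite kermx_eq0 -row_leq_rank -ltnNge.
  apply: leq_ltn_trans (rank_leq_col A) _.
  exact: leq_ltn_trans (card_bmultinom _) lt_r.
exists v => //; apply/mpolyP => m; rewrite mcoeff0.
have [le_m|lt_m] := ltnP (mdeg m) B.+1.
  rewrite -[m]/(val (BMultinom le_m)) phiE.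
  by move/sub_kermxP: vA => ->; rewrite mxE.
apply/eqP; rewrite mcoeff_eq0; apply/negP => /(deg_leP _ _ (deg_phi v)).
by rewrite leqNgt lt_m.
Qed.

(** A count of monomials bounds the transcendence degree: [size fs] exponents
    below [M] give [M ^ size fs] coefficients, while the degrees of the
    polynomials obtained grow linearly in [M]. *)
Lemma alg_indep_size q fs : 0 \in q -> alg_indep q fs -> (size fs <= n)%N.
Proof.
move=> q0 ind; rewrite leqNgt; apply/negP => lt_n.
set N := size fs in lt_n *.
pose D := \max_(f <- fs) msize f.
have degD : all (deg_le D) fs.
  apply/allP => f fs_f; apply/deg_leP => m /msize_mdeg_lt /ltnW le_m.
  by apply: leq_trans le_m _; rewrite /D (big_rem f) //= leq_maxl.
(* At most [(C * M) ^ n] monomials have degree at most [N * M * D], and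
   [M > C ^ n] makes this smaller than [M ^ n.+1 <= M ^ N]. *)
pose C := (N * D).+1; pose M := (C ^ n).+1.
pose T := {: N.-tuple 'I_M}.
pose c (v : 'rV[K]_#|T|) (e : seq nat) : K :=
  \sum_(t : T) v 0 (enum_rank t) * (map val t == e)%:R.
have c_val v (t : T) : c v (map val t) = v 0 (enum_rank t).
  rewrite /c (bigD1 t) //= eqxx mulr1 big1 ?addr0 // => t' ne_t.
  rewrite (inj_eq (inj_map val_inj)) (inj_eq val_inj) (negPf ne_t).
  by rewrite mulr0.
have lin_c : linear (fun v => eval_box fs M (c v)).
  move=> a u v; apply: eval_box_linear => e.
  rewrite /c mulr_sumr -big_split; apply: eq_bigr => t _ /=.
  by rewrite !mxE mulrDl mulrA.
have [||v v0 hv] := mpoly_linear_relation (B := (N * (M * D))%N) lin_c.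
- by move=> v; apply: deg_le_eval_box.
- rewrite card_tuple card_ord; apply: leq_ltn_trans (_ : (C * M) ^ n < _)%N.
    have le_CM : ((N * (M * D)).+1 <= C * M)%N.
      by rewrite [(C * M)%N]mulSn mulnCA [(M * _)%N]mulnC -add1n leq_add2r.
    by case: (n) => // n'; rewrite leq_exp2r.
  apply: leq_trans (leq_pexp2l (isT : 0 < M)%N lt_n).
  by rewrite expnMn expnS ltn_mul2r expn_gt0 /=.
case/eqP: v0; apply/rowP => i; rewrite mxE -[i]enum_valK -c_val.
apply: (ind M); first by rewrite hv.
rewrite /in_box size_map size_tuple eqxx all_map.
by apply/allP => x _ /=; apply: ltn_ord.
Qed.

(** Adding the variables of [S] one at a time gives a chain of length [#|S|].
    No chain [q] is longer: its steps provide elements extending the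
    variables outside [S], independent modulo the last prime, to a family
    independent modulo the first one. *)
Lemma var_prime_height (S : {set 'I_n}) :
  is_prime_height (var_prime_ideal K S) #|S|.
Proof.
split.
  exists (fun i => var_prime_ideal K [set x in take i (enum S)]).
    move=> f; congr (f \in (var_prime_ideal K _ : {pred R})).
    by apply/setP => x; rewrite inE cardE take_size mem_enum.
  move=> i; rewrite cardE => lt_i; have x0 : 'I_n by case: (enum S) lt_i.
  rewrite (take_nth x0 lt_i); set x := nth x0 _ _; split.
    apply: var_prime_subset; apply/subsetP => y.
    by rewrite !inE mem_rcons inE orbC => ->.
  move/(_ 'X_x); rewrite !var_primeX !inE mem_rcons mem_head => /(_ isT).
  have : uniq (take i (enum S) ++ drop i (enum S)).
    by rewrite cat_take_drop enum_uniq.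
  rewrite cat_uniq; case/and3P=> _ /hasPn disj _; apply/negP; apply: (disj x).
  by rewrite (drop_nth x0 lt_i) mem_head.
move=> l [q ql strict]; set s := enum (~: S).
have sS : {in s, forall i, i \notin S} by move=> i; rewrite mem_enum inE.
rewrite -(leq_add2r (size s)) -[in X in (_ <= X)%N]cardE cardsC card_ord.
have ind := alg_indep_vars (enum_uniq _) sS.
(* A non-inclusion of primes yields an element only up to double negation, so
   the whole family is built under one. *)
have step j : (j <= l)%N ->
    (forall fs, size fs = (j + size s)%N ->
       ~ alg_indep (q (l - j)%N : {pred R}) fs) -> False.
  elim: j => [_ /(_ [seq 'X_i | i <- s])|j IH lt_j no].
    rewrite size_map subn0; apply=> //; apply: eq_alg_indep ind.
    by move=> f; rewrite ql.
  apply: IH (ltnW lt_j) _ => fs sz_fs fs_ind.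
  have [|sub nsub] := strict (l - j.+1)%N; first by rewrite ltn_subrL (leq_trans _ lt_j).
  rewrite subnSK // in sub nsub.
  apply: nsub => f fq; apply: contraT => nfq.
  by case: (no (f :: fs)); [rewrite /= sz_fs | apply: alg_indep_cons fs_ind].
rewrite leqNgt; apply/negP => gt_n; apply: (step l (leqnn l)) => fs sz_fs.
by move=> /(alg_indep_size (rpred0 _)); rewrite sz_fs leqNgt gt_n.
Qed.

End Dimension.
(** * Disjoint supports and the v-number *)

Section VNumber.

Variables (K : fieldType) (n k : nat).
Local Notation R := {mpoly K[n]}.
Implicit Types (I : {pred R}) (f g : R) (a : k.-tuple 'X_{1..n}).
Implicit Types (s : 'I_k -> 'I_n).

Definition disjoint_supports a : Prop :=
  forall i j x, tnth a i x != 0%N -> tnth a j x != 0%N -> i = j.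

Lemma mnm_neq0P (m : 'X_{1..n}) : m != 0%MM -> exists x, m x != 0%N.
Proof.
move=> m0; apply/existsP; apply: contraNT m0; rewrite negb_exists => /forallP h.
by apply/eqP/mnmP => x; rewrite mnm0E; apply/eqP/negbNE.
Qed.

Lemma proper_mon_ideal_neq0 a : (1 : R) \notin mon_ideal a ->
  forall i, tnth a i != 0%MM.
Proof.
rewrite -mpolyX0 mon_idealX => /hasPn h i; apply: contra (h _ (mem_tnth i a)).
by move/eqP->; apply: lepm_refl.
Qed.

(** A variable [x] shared by two generators would serve both of them: together
    with one variable for each of the others it generates a prime containing
    the ideal, of height less than [k]. *)
Lemma height_disjoint_supports I a :
  (1 : R) \notin mon_ideal a -> I =i mon_ideal a -> is_height I k ->
  disjoint_supports a.
Proof.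
move=> /proper_mon_ideal_neq0 a0 eI [_ minh] i j x aix ajx.
have [s as_] : exists s, forall l, tnth a l (s l) != 0%N.
  by apply: (fin_all_exists (P := fun l x => tnth a l x != 0%N)) => l; apply: mnm_neq0P.
pose t l := if (l == i) || (l == j) then x else s l.
have at_ l : tnth a l (t l) != 0%N.
  by rewrite /t; case: ifP => // /orP[] /eqP->.
pose S := [set t l | l : 'I_k].
have sIS : {subset I <= (var_prime_ideal K S : {pred R})}.
  move=> f; rewrite eI => /mon_idealP hf; apply/var_primeP => m /hf[g].
  case/tnthP=> l -> /mnm_lepP le_m; exists (t l); first exact: imset_f.
  by rewrite -lt0n; apply: leq_trans (le_m _); rewrite lt0n.
have card_S := minh _ _ sIS (var_prime_height K S).
have /imset_injP inj_t : #|S| == #|'I_k|.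
  by rewrite eqn_leq leq_imset_card card_ord card_S.
by apply: inj_t; rewrite /t ?eqxx ?orbT.
Qed.

(** When [s i] occurs in the [i]-th generator and the supports are disjoint, no
    generator divides this monomial, but the [i]-th one does once it is
    multiplied by [s i]. *)
Definition stripped_mon a s : 'X_{1..n} := (\sum_i (tnth a i - U_(s i)))%MM.

Lemma stripped_monE a s i x : disjoint_supports a -> tnth a i x != 0%N ->
  stripped_mon a s x = (tnth a i x - (s i == x))%N.
Proof.
move=> dis aix; rewrite mnm_sumE (bigD1 i) //= mnmBE mnm1E big1 ?addn0 // => j.
move=> ne_ji; rewrite mnmBE; apply/eqP; rewrite subn_eq0.
have [->//|ajx] := eqVneq (tnth a j x) 0%N.
by rewrite (dis _ _ _ ajx aix) eqxx in ne_ji.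
Qed.

Lemma stripped_mon_eq0 a s x : (forall i, tnth a i x = 0%N) -> stripped_mon a s x = 0%N.
Proof. by move=> ax; rewrite mnm_sumE big1 // => i _; rewrite mnmBE ax. Qed.

Lemma mdeg_stripped_mon a s : (forall i, tnth a i (s i) != 0%N) ->
  mdeg (stripped_mon a s) = (\sum_i (mdeg (tnth a i)).-1)%N.
Proof.
move=> as_; rewrite mdeg_sum; apply: eq_bigr => i _.
have /submK {2}<- : (U_(s i) <= tnth a i)%MM by rewrite lep1mP.
by rewrite mdegD mdeg1 addn1.
Qed.

Lemma colon_stripped_mon a s :
  disjoint_supports a -> (forall i, tnth a i (s i) != 0%N) ->
  colon (mon_ideal a) 'X_[stripped_mon a s] =i
    (var_prime_ideal K [set s i | i : 'I_k] : {pred R}).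
Proof.
move=> dis as_ f; rewrite [LHS]mem_mon_ideal_mulX.
apply/allP/var_primeP => h m /h.
  case/hasP=> _ /tnthP[i ->] /mnm_lepP/(_ (s i)).
  rewrite mnmDE (stripped_monE s dis (as_ i)) eqxx => le_a.
  exists (s i); first exact: imset_f.
  apply: contraTneq le_a => ->; rewrite addn0 -ltnNge subn1 ltn_predL lt0n.
  exact: as_.
case=> _ /imsetP[i _ ->] ms; apply/hasP; exists (tnth a i); first exact: mem_tnth.
apply/mnm_lepP => x; rewrite mnmDE.
have [->//|aix] := eqVneq (tnth a i x) 0%N.
rewrite (stripped_monE s dis aix); case: eqP => [<-|_]; last by rewrite subn0 leq_addr.
by rewrite -leq_subLR subKn ?lt0n.
Qed.

Lemma prime_ideal_mpolyX (p : prime_idealr R) (m : 'X_{1..n}) :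
  'X_[m] \in (p : {pred R}) -> exists2 x, m x != 0%N & 'X_x \in (p : {pred R}).
Proof.
move=> mp.
suff /existsP[x /andP[mx xp]] :
  [exists x, (m x != 0%N) && ('X_x \in (p : {pred R}))].
  by exists x.
apply: contraTT mp; rewrite negb_exists => /forallP no; rewrite mpolyXE_id.
apply: (big_ind (fun f => f \notin (p : {pred R}))) => [|f g fp gp|x _].
- by rewrite idealr1.
- by rewrite prime_idealrM negb_or fp.
have := no x; rewrite negb_and negbK => /orP[/eqP->|xp].
  by rewrite expr0 idealr1.
by elim: (m x) => [|j IH]; rewrite ?expr0 ?idealr1 // exprS prime_idealrM negb_or xp.
Qed.

(** If [(I : f)] is prime, it contains a variable [t i] of each generator.  A
    monomial [m] of [f] outside [I] is moved into [I] by each [t i], and only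
    the [i]-th generator can be responsible, as the others do not involve
    [t i]. *)
Lemma prime_colon_degree a f d (p : prime_idealr R) :
  disjoint_supports a -> f \is d.-homog ->
  colon (mon_ideal a) f =i (p : {pred R}) ->
  (\sum_i (mdeg (tnth a i)).-1 <= d)%N.
Proof.
move=> dis /dhomogP hom_f eqp.
have [t at_ tp] : exists2 t : 'I_k -> 'I_n, forall i, tnth a i (t i) != 0%N &
    forall i, 'X_(t i) \in (p : {pred R}).
  apply: (fin_all_exists2 (P := fun i x => tnth a i x != 0%N)
                          (Q := fun i x => 'X_x \in (p : {pred R}))) => i.
  apply: prime_ideal_mpolyX; rewrite -eqp inE mulrC mon_idealM // mon_idealX.
  by apply/hasP; exists (tnth a i); rewrite ?mem_tnth ?lepm_refl.
have fI : f \notin mon_ideal a.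
  by apply/negP => fI; have := idealr1 p; rewrite -eqp inE mul1r fI.
have /allPn[m mf /hasPn nm] := fI.
have /= <- := hom_f m mf; rewrite -(mdeg_stripped_mon at_).
suff le_w : (stripped_mon a t <= m)%MM by rewrite -(submK le_w) mdegD leq_addl.
apply/mnm_lepP => x.
have [/existsP[i aix]|] := boolP [exists i, tnth a i x != 0%N]; last first.
  rewrite negb_exists => /forallP h; rewrite stripped_mon_eq0 // => i.
  by apply/eqP/negbNE.
rewrite (stripped_monE t dis aix).
have := tp i; rewrite -eqp inE mulrC mem_mon_ideal_mulX => /allP/(_ m mf).
case/hasP=> _ /tnthP[j ->] le_j.
suff e : j = i.
  by move/mnm_lepP: le_j => /(_ x); rewrite e mnmDE mnm1E leq_subLR.
have /existsP[y] : [exists y, m y < tnth a j y]%N.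
  apply: contraNT (nm _ (mem_tnth j a)); rewrite negb_exists => /forallP h.
  by apply/mnm_lepP => y; rewrite leqNgt.
move/mnm_lepP: le_j => /(_ y); rewrite mnmDE mnm1E.
have [<- _ lt_m|_ le lt] := eqVneq (t i) y; last by rewrite ltnNge le in lt.
by apply: dis (at_ i); rewrite -lt0n; apply: leq_ltn_trans lt_m.
Qed.

Lemma is_v_number_disjoint I a :
  I =i mon_ideal a -> (forall i, tnth a i != 0%MM) -> disjoint_supports a ->
  is_v_number I (\sum_i (mdeg (tnth a i)).-1).
Proof.
move=> eI a0 dis.
have eC f : colon I f =i colon (mon_ideal a) f by move=> g; rewrite !inE eI.
split=> [|d [f [p [hom_f _ eqp]]]]; last first.
  by apply: (prime_colon_degree (p := p) dis hom_f) => g; rewrite -eC.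
have [s as_] : exists s, forall l, tnth a l (s l) != 0%N.
  by apply: (fin_all_exists (P := fun l x => tnth a l x != 0%N)) => l; apply: mnm_neq0P.
have eqp : colon I 'X_[stripped_mon a s] =i
    (var_prime_ideal K [set s i | i : 'I_k] : {pred R}).
  by move=> g; rewrite eC colon_stripped_mon.
exists 'X_[stripped_mon a s], (var_prime_ideal K [set s i | i : 'I_k]); split=> //.
  by rewrite -(mdeg_stripped_mon as_) dhomogX.
by exists 'X_[stripped_mon a s].
Qed.

End VNumber.

(** * Comparison of minimal graded free resolutions *)

Section HomogeneousParts.

Variables (K : fieldType) (n : nat).
Local Notation R := {mpoly K[n]}.
Implicit Types (f g : R) (e : int) (G : seq 'X_{1..n}).

(** Degrees are integers because the differences of shifts may be negative. *)
Definition homog_part e f : R := if e is Posz d then pihomog mdeg d f else 0.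

Lemma mcoeff_homog_part e f m :
  (homog_part e f)@_m = if (mdeg m)%:Z == e then f@_m else 0.
Proof.
case: e => [d|d] /=; last by rewrite mcoeff0.
rewrite eqz_nat pihomogE raddf_sum /=.
under eq_bigr => m' _ do rewrite mcoeffZ mcoeffX.
have [mf|mf] := boolP (m \in msupp f); last first.
  rewrite (memN_msupp_eq0 mf) if_same big_seq_cond big1 // => m' /andP[m'f _].
  by case: (eqVneq m' m) m'f => [->|_ _]; rewrite ?(negPf mf) ?mulr0.
case: eqP => [md|md].
  rewrite (big_rem m) //= md eqxx eqxx mulr1 big_seq_cond big1 ?addr0 // => m'.
  by rewrite mem_rem_uniq ?msupp_uniq // inE => /andP[/andP[/negPf-> _] _]; rewrite mulr0.
rewrite big1 // => m' /eqP m'd.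
by case: (eqVneq m' m) m'd => [-> /md|_ _]; rewrite ?mulr0.
Qed.

Lemma homog_part_homog e f : homog_of_degree e (homog_part e f).
Proof.
move=> m; rewrite mcoeff_msupp mcoeff_homog_part.
by case: (_ =P e) => [//|_]; rewrite eqxx.
Qed.

Lemma homog_part_id e f : homog_of_degree e f -> homog_part e f = f.
Proof.
move=> hf; apply/mpolyP => m; rewrite mcoeff_homog_part; case: (_ =P e) => // ne.
have [/hf//|mf] := boolP (m \in msupp f).
by rewrite (memN_msupp_eq0 mf).
Qed.

Lemma homog_partB e f g : homog_part e (f - g) = homog_part e f - homog_part e g.
Proof.
apply/mpolyP => m; rewrite mcoeffB !mcoeff_homog_part mcoeffB.
by case: ifP; rewrite ?subr0.
Qed.

Lemma homog_part_sum e (T : Type) (r : seq T) (F : T -> R) :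
  homog_part e (\sum_(t <- r) F t) = \sum_(t <- r) homog_part e (F t).
Proof.
apply/mpolyP => m; rewrite mcoeff_homog_part !(raddf_sum (mcoeff m)).
rewrite [RHS](eq_bigr _ (fun t _ => mcoeff_homog_part e (F t) m)).
by case: ifP => // _; rewrite big1.
Qed.

Lemma homog_partM e e' f g : homog_of_degree e' g ->
  homog_part (e + e') (f * g) = homog_part e f * g.
Proof.
move=> hg; apply/mpolyP => m; rewrite mcoeff_homog_part !mcoeffM.
transitivity (\sum_(k : 'X_{1..n < (mdeg m).+1, (mdeg m).+1} | m == (k.1 + k.2)%MM)
  if (mdeg m)%:Z == e + e' then f@_k.1 * g@_k.2 else 0).
  by case: ifP => _ //; rewrite big1.
apply: eq_bigr => -[[k1 ?] [k2 ?]] /= /eqP->; rewrite mcoeff_homog_part.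
have [k2g|k2g] := boolP (k2 \in msupp g); last first.
  by rewrite (memN_msupp_eq0 k2g) !mulr0 if_same.
rewrite -(hg _ k2g) mdegD PoszD (inj_eq (addIr _)).
by case: ifP; rewrite ?mul0r.
Qed.

Lemma homog_part_mon_ideal G e f :
  f \in mon_ideal G -> homog_part e f \in mon_ideal G.
Proof.
move=> /mon_idealP hf; apply/mon_idealP => m mf; apply: hf; move: mf.
rewrite !mcoeff_msupp mcoeff_homog_part.
by case: ifP => [//|_]; rewrite eqxx.
Qed.

Definition graded_matrix p q (a : 'I_p -> int) (b : 'I_q -> int)
    (A : 'M[R]_(p, q)) : Prop :=
  forall s t, homog_of_degree (a s - b t) (A s t).

Definition graded_part p q (a : 'I_p -> int) (b : 'I_q -> int)
    (A : 'M[R]_(p, q)) : 'M[R]_(p, q) :=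
  \matrix_(s, t) homog_part (a s - b t) (A s t).

Lemma graded_part_graded p q a b (A : 'M[R]_(p, q)) :
  graded_matrix a b (graded_part a b A).
Proof. by move=> s t; rewrite mxE; apply: homog_part_homog. Qed.

Lemma graded_part_id p q a b (A : 'M[R]_(p, q)) :
  graded_matrix a b A -> graded_part a b A = A.
Proof. by move=> hA; apply/matrixP => s t; rewrite mxE homog_part_id. Qed.

Lemma graded_partM p q r a b c (A : 'M[R]_(p, q)) (B : 'M[R]_(q, r)) :
  graded_matrix b c B ->
  graded_part a c (A *m B) = graded_part a b A *m B.
Proof.
move=> hB; apply/matrixP => s t; rewrite !mxE homog_part_sum.
apply: eq_bigr => u _; rewrite mxE -(homog_partM _ _ (hB u t)).
by congr homog_part; rewrite addrA subrK.
Qed.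

Lemma graded_matrixM p q r a b c (A : 'M[R]_(p, q)) (B : 'M[R]_(q, r)) :
  graded_matrix a b A -> graded_matrix b c B -> graded_matrix a c (A *m B).
Proof.
move=> hA hB; rewrite -(graded_part_id hA) -(graded_partM _ _ hB).
exact: graded_part_graded.
Qed.

End HomogeneousParts.

Section Comparison.

Variables (K : fieldType) (n : nat).
Local Notation R := {mpoly K[n]}.
Variable M : seq 'X_{1..n}.
Local Notation I := (mon_ideal M : {pred R}).
Implicit Types (F G : free_complex K n).

Definition mx_in_ideal p q (A : 'M[R]_(p, q)) : Prop := forall s t, A s t \in I.

Lemma mx_in_idealN p q (A : 'M[R]_(p, q)) : mx_in_ideal A -> mx_in_ideal (- A).
Proof. by move=> hA s t; rewrite mxE mon_idealN. Qed.

Lemma mx_in_idealB p q (A B : 'M[R]_(p, q)) :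
  mx_in_ideal A -> mx_in_ideal B -> mx_in_ideal (A - B).
Proof. by move=> hA hB s t; rewrite !mxE mon_idealB. Qed.

Lemma mx_in_idealM p q r (A : 'M[R]_(p, q)) (B : 'M[R]_(q, r)) :
  mx_in_ideal B -> mx_in_ideal (A *m B).
Proof.
by move=> hB s t; rewrite mxE mon_ideal_sum // => u _; rewrite mon_idealM.
Qed.

Lemma row_lift p q r (U : 'M[R]_(p, q)) (D : 'M[R]_(r, q)) :
  (forall s, exists w : 'rV_r, row s U = w *m D) -> exists W, U = W *m D.
Proof.
move=> /(fin_all_exists (P := fun s w => row s U = w *m D))[w hw].
exists (\matrix_s w s); apply/row_matrixP => s.
by rewrite row_mul rowK.
Qed.

Section Resolution.

Variable F : free_complex K n.
Hypothesis resF : resolves F I.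

Lemma resolves_aug p (v : 'cV[R]_p) :
  exists U, mx_in_ideal (v - U *m faug F).
Proof.
have [aug _ _] := resF.
have [u hu] := fin_all_exists (P := fun s u => v s 0 - (u *m faug F) 0 0 \in I)
                 (fun s => aug (v s 0)).
exists (\matrix_s u s) => s t; rewrite ord1.
have := hu s; rewrite -[u s](rowK u) -row_mul.
by rewrite [X in _ - X]mxE [X in _ -> X \in _]mxE [X in _ -> _ + X \in _]mxE.
Qed.

Lemma resolves_diff0 : mx_in_ideal (fdiff F 0 *m faug F).
Proof.
have [_ ex _] := resF; move=> s t; rewrite ord1.
have /ex : exists w, row s (fdiff F 0) = w *m fdiff F 0.
  by exists (delta_mx 0 s); rewrite rowE.
by rewrite -row_mul mxE.
Qed.

Lemma resolves_lift0 p (U : 'M[R]_(p, frank F 0)) :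
  mx_in_ideal (U *m faug F) -> exists W, U = W *m fdiff F 0.
Proof.
have [_ ex _] := resF; move=> hU; apply: row_lift => s; apply/ex.
by rewrite -row_mul mxE.
Qed.

Lemma resolves_diff i : fdiff F i.+1 *m fdiff F i = 0.
Proof.
have [_ _ ex] := resF; apply/row_matrixP => s; rewrite row_mul row0.
by apply/ex; exists (delta_mx 0 s); rewrite rowE.
Qed.

Lemma resolves_lift i p (U : 'M[R]_(p, frank F i.+1)) :
  U *m fdiff F i = 0 -> exists W, U = W *m fdiff F i.+1.
Proof.
have [_ _ ex] := resF; move=> hU; apply: row_lift => s; apply/ex.
by rewrite -row_mul hU row0.
Qed.

End Resolution.

Definition const_mx0 p q (A : 'M[R]_(p, q)) : 'M[K]_(p, q) :=
  map_mx (mcoeff 0%MM) A.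

Local Notation shift F i := (@fshift _ _ F i).

(** The inductive invariant relating two resolutions in degree [i]: [phi] and
    [psi] are the components of chain maps over the identity of [R / I], whose
    next components exist, and [h] is the component of a homotopy from the
    identity to their composite. *)
Definition comparison F G i : Prop :=
  exists (phi : 'M[R]_(frank F i, frank G i))
         (psi : 'M[R]_(frank G i, frank F i))
         (h : 'M[R]_(frank F i, frank F i.+1)),
  [/\ graded_matrix (shift F i) (shift G i) phi,
      exists phi', fdiff F i *m phi = phi' *m fdiff G i,
      exists psi', fdiff G i *m psi = psi' *m fdiff F i,
      fdiff F i *m (phi *m psi - 1%:M - h *m fdiff F i) = 0 &
      const_mx0 phi *m const_mx0 psi = 1%:M].

Lemma minimal_const_mx0 F i : minimal_complex F -> const_mx0 (fdiff F i) = 0.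
Proof. by move=> minF; apply/matrixP => s t; rewrite !mxE. Qed.

Section Step.

Variables F G : free_complex K n.
Hypotheses (grF : graded_complex F) (grG : graded_complex G).
Hypotheses (resF : resolves F I) (resG : resolves G I).
Hypothesis minF : minimal_complex F.

(** Homogeneous parts of [phi0] still lift the identity, since the augmentations
    and the ideal are homogeneous. *)
Lemma comparison0 : comparison F G 0.
Proof.
have [phi0 hphi0] := resolves_aug resG (faug F).
have [psi hpsi] := resolves_aug resF (faug G).
set phi := graded_part (shift F 0) (shift G 0) phi0.
have hphi : mx_in_ideal (faug F - phi *m faug G).
  have gr_aug (E : free_complex K n) : graded_complex E ->
      graded_matrix (shift E 0) (fun _ : 'I_1 => 0) (faug E).
    by move=> [gr _] s t; rewrite ord1 subr0; apply: gr.
  rewrite /phi -(graded_partM _ _ (gr_aug _ grG)).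
  rewrite -[faug F](graded_part_id (gr_aug _ grF)).
  move=> s t; rewrite !mxE -homog_partB; apply: homog_part_mon_ideal.
  by have := hphi0 s t; rewrite !mxE.
have [phi' hphi'] : exists phi', fdiff F 0 *m phi = phi' *m fdiff G 0.
  apply: (resolves_lift0 resG).
  rewrite -mulmxA -[phi *m _](subKr (faug F)) mulmxBr.
  by apply: mx_in_idealB; [apply: resolves_diff0 | apply: mx_in_idealM].
have [psi' hpsi'] : exists psi', fdiff G 0 *m psi = psi' *m fdiff F 0.
  apply: (resolves_lift0 resF).
  rewrite -mulmxA -[psi *m _](subKr (faug G)) mulmxBr.
  by apply: mx_in_idealB; [apply: resolves_diff0 | apply: mx_in_idealM].
have [h hh] : exists h, phi *m psi - 1%:M = h *m fdiff F 0.
  apply: (resolves_lift0 resF).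
  rewrite (_ : _ *m _ = - (faug F - phi *m faug G) - phi *m (faug G - psi *m faug F)).
    by apply: mx_in_idealB; [apply: mx_in_idealN | apply: mx_in_idealM].
  by rewrite mulmxBl mul1mx -mulmxA mulmxBr !opprB [RHS]addrC addrA subrK.
exists phi, psi, h; split.
- exact: graded_part_graded.
- by exists phi'.
- by exists psi'.
- by rewrite hh subrr mulmx0.
rewrite /const_mx0 -map_mxM -[phi *m psi](subrK 1%:M) hh map_mxD map_mxM.
rewrite -/(const_mx0 (fdiff F 0)) (minimal_const_mx0 0 minF) mulmx0 add0r.
by rewrite map_scalar_mx rmorph1.
Qed.

(** [phi' psi'] and the identity are chain maps which agree up to the homotopy
    [h] one degree below, so their difference corrected by [h] consists of
    cycles, hence of boundaries. *)
Lemma comparisonS i : comparison F G i -> comparison F G i.+1.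
Proof.
case=> phi [psi [h [gr_phi [phi0 hphi0] [psi' hpsi'] hom _]]].
have gr_diff (E : free_complex K n) j : graded_complex E ->
    graded_matrix (shift E j.+1) (shift E j) (fdiff E j).
  by case=> _ gr; apply: gr.
pose phi' := graded_part (shift F i.+1) (shift G i.+1) phi0.
have hphi' : fdiff F i *m phi = phi' *m fdiff G i.
  rewrite -(graded_partM _ _ (gr_diff _ _ grG)) -hphi0 graded_part_id //.
  exact: graded_matrixM (gr_diff _ _ grF) gr_phi.
have [h' hh'] : exists h', phi' *m psi' - 1%:M - fdiff F i *m h = h' *m fdiff F i.+1.
  apply: (resolves_lift resF); rewrite -[RHS]hom !mulmxBr !mulmxBl mulmx1 mul1mx.
  by rewrite -!mulmxA -hpsi' !mulmxA hphi'.
exists phi', psi', h'; split.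
- exact: graded_part_graded.
- apply: (resolves_lift resG).
  by rewrite -mulmxA -hphi' mulmxA (resolves_diff resF) mul0mx.
- apply: (resolves_lift resF).
  by rewrite -mulmxA -hpsi' mulmxA (resolves_diff resG) mul0mx.
- by rewrite -hh' subKr mulmxA (resolves_diff resF) mul0mx.
rewrite /const_mx0 -map_mxM -[phi' *m psi'](subrK 1%:M).
rewrite -[phi' *m psi' - _](subrK (fdiff F i *m h)) hh' !map_mxD !map_mxM.
rewrite -!/(const_mx0 (fdiff F _)) !minimal_const_mx0 // mulmx0 mul0mx !add0r.
by rewrite map_scalar_mx rmorph1.
Qed.

Lemma comparisonP i : comparison F G i.
Proof. by elim: i => [|i]; [apply: comparison0 | apply: comparisonS]. Qed.

(** Modulo the variables the comparison map is invertible, so each row has a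
    nonzero constant entry; being homogeneous, that entry has degree 0. *)
Lemma minimal_resolution_shift i s : exists t, shift F i s = shift G i t.
Proof.
have [phi [psi [h [gr_phi _ _ _ /matrixP/(_ s s)]]]] := comparisonP i.
rewrite !mxE eqxx => e1; have /existsP[t pst] : [exists t, (phi s t)@_0%MM != 0].
  apply: contraT; rewrite negb_exists => /forallP h0.
  move/eqP: e1; rewrite big1 1?eq_sym ?oner_eq0 // => t _.
  by rewrite mxE; move/negbNE/eqP: (h0 t) => ->; rewrite mul0r.
exists t; apply/eqP; rewrite -subr_eq0 -(gr_phi s t 0%MM) ?mdeg0 //.
by rewrite mcoeff_msupp.
Qed.

End Step.
End Comparison.

(** * The Koszul resolution *)

Section Koszul.

Variables (K : fieldType) (n : nat).
Local Notation R := {mpoly K[n]}.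
Implicit Types (F : free_complex K n) (m : 'X_{1..n}) (M : seq 'X_{1..n}).

Local Notation shift F i := (@fshift _ _ F i).

(** The component before degree 0 is zero; naming it gives the cone the same
    shape in every degree. *)
Definition prev_rank F i : nat := if i is j.+1 then frank F j else 0%N.

Definition prev_shift F i : 'I_(prev_rank F i) -> int :=
  match i return 'I_(prev_rank F i) -> int with
  | 0 => fun=> 0
  | j.+1 => shift F j
  end.

Definition prev_diff F i : 'M[R]_(frank F i, prev_rank F i) :=
  match i return 'M[R]_(frank F i, prev_rank F i) with
  | 0 => 0
  | j.+1 => fdiff F j
  end.

(** The mapping cone of multiplication by ['X_[m]] on [F]; its degree [i]
    component is that of [F] plus the one before, shifted by [mdeg m]. *)
Definition mon_cone F m : free_complex K n :=
  @FreeComplex K n (fun i => frank F i + prev_rank F i)%N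
    (fun i s => match split s with
                | inl t => shift F i t
                | inr t => prev_shift t + (mdeg m)%:Z
                end)
    (fun i => block_mx (fdiff F i) 0 ('X_[m])%:M (- prev_diff F i))
    (col_mx (faug F) (0 : 'cV_(prev_rank F 0))).

Lemma mon_cone_graded F m : graded_complex F -> graded_complex (mon_cone F m).
Proof.
have h0 e : homog_of_degree e (0 : R) by move=> m'; rewrite msupp0.
case=> gr_aug gr; split=> [s|i s t].
  by case: (split_ordP s) => [s' ->|[]//]; rewrite /= col_mxEu (unsplitK (inl s')).
have [s' ->|s' ->] := split_ordP s; have [t' ->|t' ->] := split_ordP t => /=.
- by rewrite (unsplitK (inl s')) (unsplitK (inl t')) block_mxEul.
- by rewrite block_mxEur mxE.
- rewrite (unsplitK (inr s')) (unsplitK (inl t')) block_mxEdl mxE.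
  have [->|_] := eqVneq; last exact: h0.
  by move=> m'; rewrite mulr1n msuppX inE => /eqP->; rewrite addrAC subrr add0r.
rewrite (unsplitK (inr s')) (unsplitK (inr t')) block_mxEdr mxE => m'.
rewrite (perm_mem (msuppN _)); case: i s s' t t' => [|i] s s' t t'; first by case: t'.
by move/gr; rewrite opprD addrACA subrr addr0.
Qed.

Lemma mon_cone_minimal F m : m != 0%MM ->
  minimal_complex F -> minimal_complex (mon_cone F m).
Proof.
move=> m0 minF i s t.
have [s' ->|s' ->] := split_ordP s; have [t' ->|t' ->] := split_ordP t => /=.
- by rewrite block_mxEul.
- by rewrite block_mxEur mxE mcoeff0.
- by rewrite block_mxEdl mxE mcoeffMn mcoeffX (negPf m0) mul0rn.
rewrite block_mxEdr mxE mcoeffN; case: i s s' t t' => [|i] s s' t t' /=.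
  by case: t'.
by rewrite minF oppr0.
Qed.

(** ['X_[m]] is a nonzerodivisor modulo the ideal, since adding [m] to an
    exponent does not help it reach a generator whose support avoids that of
    [m]. *)
Lemma mon_ideal_regular M m (f : R) :
  {in M, forall (g : 'X_{1..n}) x, g x != 0%N -> m x = 0%N} ->
  f * 'X_[m] \in mon_ideal M -> f \in mon_ideal M.
Proof.
move=> dis; rewrite mem_mon_ideal_mulX => /allP h; apply/mon_idealP => m' /h.
case/hasP=> g gM /mnm_lepP le_g; exists g => //; apply/mnm_lepP => x.
have [->//|gx] := eqVneq (g x) 0%N.
by have := le_g x; rewrite mnmDE (dis g gM x gx).
Qed.

Lemma mem_mon_ideal_cons M m (f : R) : uniq (m :: M) ->
  (f \in mon_ideal (m :: M)) <-> exists g, f - g * 'X_[m] \in mon_ideal M.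
Proof.
move=> uM; split=> [/(mon_generates_mon_ideal uM)[c ->]|[g hg]].
  exists (c m); rewrite big_cons addrAC subrr add0r.
  by apply/(mon_generates_mon_ideal (proj2 (andP uM))); exists c.
rewrite -[f](subrK (g * 'X_[m])) mon_idealD //.
  by apply: mon_ideal_subset hg => x xM; rewrite inE xM orbT.
by rewrite mon_idealM // mon_idealX /= lepm_refl.
Qed.

(** A cycle [(u1, u2)] of the cone has [u2] a cycle of [F], hence a boundary;
    subtracting a boundary of the cone reduces to [u2 = 0], where [u1] is a
    cycle of [F]. *)
Lemma mon_cone_resolves F M m :
  uniq (m :: M) -> {in M, forall (g : 'X_{1..n}) x, g x != 0%N -> m x = 0%N} ->
  resolves F (mon_ideal M) -> resolves (mon_cone F m) (mon_ideal (m :: M)).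
Proof.
move=> uM dis resF; have [aug ex0 ex] := resF.
have mulX p (u : 'M[R]_(1, p)) : u *m ('X_[m])%:M = 'X_[m] *: u.
  by rewrite mul_mx_scalar.
have uE p q (u : 'rV[R]_(p + q)) : u = row_mx (lsubmx u) (rsubmx u).
  by rewrite hsubmxK.
have augE (u : 'rV_(frank F 0)) (v : 'rV_(prev_rank F 0)) :
    row_mx u v *m faug (mon_cone F m) = u *m faug F.
  by rewrite mul_row_col mulmx0 addr0.
have diffE i (u : 'rV_(frank F i.+1)) (v : 'rV_(frank F i)) :
    row_mx u v *m fdiff (mon_cone F m) i =
    row_mx (u *m fdiff F i + 'X_[m] *: v) (- (v *m prev_diff F i)).
  by rewrite mul_row_block mulmx0 add0r mulX mulmxN.
split=> [f|u|i u].
- have [u hu] := aug f; exists (row_mx u 0); rewrite augE.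
  by apply: mon_ideal_subset hu => x xM; rewrite inE xM orbT.
- rewrite (uE _ _ u) augE; set u1 := lsubmx u.
  have -> : rsubmx u = 0 by apply/matrixP => ? [].
  rewrite mem_mon_ideal_cons //; split=> [[g hg]|[w]].
    have [v hv] := aug g.
    have /ex0[w hw] : ((u1 - 'X_[m] *: v) *m faug F) 0 0 \in mon_ideal M.
      rewrite mulmxBl -scalemxAl.
      rewrite (_ : _ 0 0 = ((u1 *m faug F) 0 0 - g * 'X_[m]) +
                 'X_[m] * (g - (v *m faug F) 0 0)).
        by rewrite mon_idealD // mon_idealM.
      rewrite [LHS]mxE [X in _ + X = _]mxE [X in _ - X = _]mxE.
      by rewrite mulrBr [g * _]mulrC addrA subrK.
    exists (row_mx w v); rewrite diffE -hw subrK mulmx0 oppr0; congr row_mx.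
  rewrite (uE _ _ w) diffE => /eq_row_mx[-> _].
  exists (((rsubmx w) *m faug F) 0 0); rewrite mulmxDl -scalemxAl.
  rewrite [X in X - _]mxE [X in _ + X - _]mxE mulrC addrK.
  by apply/ex0; exists (lsubmx w).
rewrite (uE _ _ u) diffE; set u1 := lsubmx u; set u2 := rsubmx u.
split=> [|[w]]; last first.
  rewrite (uE _ _ w) diffE => /eq_row_mx[-> ->].
  rewrite mulmxDl -scalemxAl -mulmxA (resolves_diff resF) mulmx0 add0r.
  rewrite scalerN subrr mulNmx opprK -mulmxA; case: i u u1 u2 w => [|i] *.
    by rewrite !mulmx0 row_mx0.
  by rewrite /= (resolves_diff resF) mulmx0 row_mx0.
rewrite -[0]row_mx0 => /eq_row_mx[d1 /eqP]; rewrite oppr_eq0 => /eqP d2.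
(* In degree 0, [d1] puts the image of ['X_[m] *: u2] in the ideal, and
   regularity removes the factor ['X_[m]]. *)
have [w2 hw2] : exists w2, u2 = w2 *m fdiff F i.
  case: i u u1 u2 d1 d2 => [|i] u u1 u2 d1 d2; last exact/ex.
  apply/ex0; apply: mon_ideal_regular dis _.
  rewrite mulrC.
  have := congr1 (fun A => (A *m faug F) 0 0) d1.
  rewrite mul0mx mulmxDl -scalemxAl [LHS]mxE [X in _ + X = _]mxE [RHS]mxE.
  move/eqP; rewrite addrC addr_eq0 => /eqP->; apply: mon_idealN.
  by apply/ex0; exists u1.
have /ex[w1 hw1] : (u1 + 'X_[m] *: w2) *m fdiff F i = 0.
  by rewrite mulmxDl -scalemxAl -hw2.
exists (row_mx w1 (- w2)); rewrite diffE -hw1 scalerN addrK mulNmx opprK.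
by rewrite /= -hw2.
Qed.

Definition unit_complex : free_complex K n :=
  @FreeComplex K n (fun i => (i == 0)%N : nat) (fun _ _ => 0) (fun _ => 0)
    (const_mx 1).

Definition koszul M : free_complex K n := foldr (fun m F => mon_cone F m) unit_complex M.

Lemma unit_complex_resolution :
  min_graded_free_resolution unit_complex (mon_ideal [::]).
Proof.
have rV0 (u v : 'rV[R]_0) : u = v by apply/rowP => -[].
split; last by move=> i s t; rewrite mxE mcoeff0.
  split=> [s m|i s t m]; last by rewrite mxE msupp0.
  by rewrite mxE msupp1 inE => /eqP->; rewrite mdeg0.
have augE (u : 'rV[R]_1) : (u *m const_mx 1 : 'M_1) 0 0 = u 0 0.
  by rewrite mxE big_ord1 mxE mulr1.
split=> [f|u|i u].
- by exists (const_mx f); rewrite augE mxE subrr mon_ideal0.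
- rewrite augE mon_ideal_nil; split=> [/eqP u0|[w ->]].
    by exists 0; rewrite mulmx0; apply/rowP => j; rewrite ord1 u0 mxE.
  by rewrite mulmx0 mxE.
by split=> _; [exists 0; apply: rV0 | apply: mulmx0].
Qed.

Lemma koszul_resolution M :
  uniq M -> {in M, forall m, m != 0%MM} ->
  {in M &, forall (g m : 'X_{1..n}) x, g x != 0%N -> m x != 0%N -> g = m} ->
  min_graded_free_resolution (koszul M) (mon_ideal M).
Proof.
elim: M => [|m M IH] uM nzM dis; first exact: unit_complex_resolution.
have sM : {subset M <= m :: M} by move=> x xM; rewrite inE xM orbT.
have [|x /sM/nzM//||gr res min] := IH; first by case/andP: uM.
  by move=> x y /sM xM /sM yM; apply: dis.
have mM : m \in m :: M by rewrite mem_head.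
split; first exact: mon_cone_graded.
  apply: mon_cone_resolves => // g gM x gx; apply/eqP/negPn/negP => mx.
  by case/andP: uM => /negP[]; rewrite -(dis _ _ (sM _ gM) mM x gx mx).
by apply: mon_cone_minimal => //; apply: nzM.
Qed.

End Koszul.

(** * Regularity *)

Section Regularity.

Variables (K : fieldType) (n : nat).
Local Notation R := {mpoly K[n]}.
Implicit Types (F G : free_complex K n) (m : 'X_{1..n}) (M : seq 'X_{1..n}).

Local Notation shift F i := (@fshift _ _ F i).

Lemma betti_neq0P F i j : betti F i j <> 0%N <-> exists s, shift F i s = j.
Proof.
split=> [/eqP|[s sj] /eqP]; first rewrite -lt0n => /card_gt0P[s].
  by rewrite inE => /eqP; exists s.
by rewrite cards_eq0 => /eqP/setP/(_ s); rewrite !inE sj eqxx.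
Qed.

Lemma is_max_betti_degreeP F r :
  is_max_betti_degree F r <->
  (exists i s, shift F i s - i%:Z = r) /\ (forall i s, shift F i s - i%:Z <= r).
Proof.
split=> -[[i hi] hr]; split.
- by case: hi => j [/betti_neq0P[s <-] e]; exists i, s.
- by move=> i' s; apply: hr; apply/betti_neq0P; exists s.
- by case: hi => s e; exists i, (shift F i s); split=> //; apply/betti_neq0P; exists s.
by move=> i' j /betti_neq0P[s <-].
Qed.

(** The shifted copy of [F] adds [mdeg m] to the shifts and 1 to the homological
    degree; as [mdeg m >= 1], it carries the new maximum. *)
Lemma mon_cone_max_betti_degree F m r : m != 0%MM ->
  is_max_betti_degree F r ->
  is_max_betti_degree (mon_cone F m) (r + ((mdeg m)%:Z - 1)).
Proof.
rewrite -mdeg_eq0 => m0 /is_max_betti_degreeP[[i [s hs]] hr].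
apply/is_max_betti_degreeP; split.
  exists i.+1, (rshift (frank F i.+1) (s : 'I_(prev_rank F i.+1))) => /=.
  by rewrite (unsplitK (inr _)) /=; lia.
move=> i' s' /=; case: (split s') => t; first by have := hr i' t; lia.
by case: i' t {s'} => [|i'] [] //= t lt_t; have := hr i' (Ordinal lt_t); lia.
Qed.

Lemma koszul_max_betti_degree M : {in M, forall m, m != 0%MM} ->
  is_max_betti_degree (koszul K M) (\sum_(m <- M) ((mdeg m)%:Z - 1)).
Proof.
elim: M => [_|m M IH nzM].
  rewrite big_nil; apply/is_max_betti_degreeP; split=> [|i s]; last first.
    by case: i s => [|i] [].
  by exists 0%N, ord0.
rewrite big_cons addrC; apply: mon_cone_max_betti_degree.
  by apply: nzM; rewrite mem_head.
by apply: IH => x xM; apply: nzM; rewrite inE xM orbT.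
Qed.

Lemma is_max_betti_degree_minimal M F G r :
  min_graded_free_resolution F (mon_ideal M) ->
  min_graded_free_resolution G (mon_ideal M) ->
  is_max_betti_degree F r -> is_max_betti_degree G r.
Proof.
move=> [grF resF minF] [grG resG minG] /is_max_betti_degreeP[[i [s hs]] hr].
apply/is_max_betti_degreeP; split=> [|j t].
  have [t ht] := minimal_resolution_shift grF grG resF resG minF s.
  by exists i, t; rewrite -ht.
by have [u ->] := minimal_resolution_shift grG grF resG resF minG t.
Qed.

Lemma eq_min_graded_free_resolution F (I J : {pred R}) :
  I =i J -> min_graded_free_resolution F I -> min_graded_free_resolution F J.
Proof.
move=> eIJ [gr [aug ex0 ex] min]; split=> //; split=> // [f|u].
  by have [u hu] := aug f; exists u; rewrite -eIJ.
by rewrite -eIJ.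
Qed.

Lemma is_regularity_disjoint (I : {pred R}) M :
  I =i mon_ideal M -> uniq M -> {in M, forall m, m != 0%MM} ->
  {in M &, forall (g m : 'X_{1..n}) x, g x != 0%N -> m x != 0%N -> g = m} ->
  is_regularity I (\sum_(m <- M) ((mdeg m)%:Z - 1)).
Proof.
move=> eI uM nzM dis; have res := koszul_resolution K uM nzM dis.
split=> [|F resF].
  by exists (koszul K M); apply: eq_min_graded_free_resolution res => f; rewrite eI.
apply: (is_max_betti_degree_minimal res); last exact: koszul_max_betti_degree.
exact: eq_min_graded_free_resolution resF.
Qed.

End Regularity.

Theorem proposition3p10 (K : fieldType) (n k : nat) (I : {pred {mpoly K[n]}})
    (a : k.-tuple 'X_{1..n}) :
  complete_intersection I -> min_mon_generators I a ->
  exists v : nat,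
    [/\ is_v_number I v,
        v%:Z = \sum_(i < k) (mdeg (tnth a i))%:Z - k%:Z &
        is_regularity I (\sum_(i < k) (mdeg (tnth a i))%:Z - k%:Z)].
Proof.
move=> [I1 [G minG htI]] mina; have [ua gena _] := mina.
have eI := mon_generatesE ua gena.
have a1 : 1 \notin (mon_ideal a : {pred {mpoly K[n]}}) by rewrite -eI.
have a0 := proper_mon_ideal_neq0 a1.
have htk : is_height I k.
  have eGa := min_mon_generators_unique minG mina.
  have [uG _ _] := minG.
  by rewrite -(size_tuple a) -(perm_size (uniq_perm uG ua eGa)).
have dis := height_disjoint_supports a1 eI htk.
have sumE : \sum_(m <- a) ((mdeg m)%:Z - 1) = \sum_(i < k) (mdeg (tnth a i))%:Z - k%:Z.
  by rewrite big_tuple sumrB sumr_const card_ord natz.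
exists (\sum_i (mdeg (tnth a i)).-1)%N; split.
- exact: is_v_number_disjoint.
- rewrite -sumE big_tuple (big_morph Posz PoszD (erefl 0%:Z)); apply: eq_bigr => i _.
  by have := a0 i; rewrite -mdeg_eq0; lia.
rewrite -sumE; apply: is_regularity_disjoint => //.
  by move=> _ /tnthP[i ->].
move=> _ _ /tnthP[i ->] /tnthP[j ->] x aix ajx.
by rewrite (dis i j x).
Qed.
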